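(* Let $R$ be a finite commutative ring with unity, let $k \in R$ be an idempotent element, and let $n \geq 2$ be an integer. Then the sets $LO_n(k,R)$ and $RO_n(k,R)$ of left and right $k$-orthogonal matrices in $M_n(R)$, respectively, are semigroups under matrix multiplication.
   Context: $M_n(R)$ is the ring of $n\times n$ matrices over $R$, with identity matrix $I_n$; rings have unity $1_R \neq 0$. For a fixed $k\in R$, a matrix $A\in M_n(R)$ is left $k$-orthogonal if $A^TA = kI_n$, and right $k$-orthogonal if $AA^T = kI_n$. $LO_n(k,R)=\{A\in M_n(R) : A^TA=kI_n\}$ and $RO_n(k,R)=\{A\in M_n(R) : AA^T=kI_n\}$. An element $k$ is idempotent if $k^2=k$. A semigroup is a nonempty set with an associative binary operation under which it is closed. *)

(* Defs.v *)
From mathcomp Require Import all_boot all_order all_algebra.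

Set Implicit Arguments.
Unset Strict Implicit.
Unset Printing Implicit Defensive.

Import GRing.Theory.
Local Open Scope ring_scope.

Definition is_semigroup (T : finType) (op : T -> T -> T) (S : {set T}) : Prop :=
  [/\ S != set0,
      {in S &, forall x y, op x y \in S}
    & {in S & &, forall x y z, op x (op y z) = op (op x y) z}].

Definition left_orthogonal (R : nzRingType) (n : nat) (k : R) (A : 'M[R]_n) :
  bool := A^T *m A == k%:M.

Definition right_orthogonal (R : nzRingType) (n : nat) (k : R) (A : 'M[R]_n) :
  bool := A *m A^T == k%:M.

Definition LO (R : finNzRingType) (n : nat) (k : R) : {set 'M[R]_n} :=
  [set A : 'M[R]_n | left_orthogonal k A].

Definition RO (R : finNzRingType) (n : nat) (k : R) : {set 'M[R]_n} :=
  [set A : 'M[R]_n | right_orthogonal k A].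

(* Main.v *)
Require Import Defs.
From mathcomp Require Import all_boot all_order all_algebra.
Local Open Scope ring_scope.

Import GRing.Theory.

(** Orthogonality factors multiply: in [B^T *m (A^T *m A) *m B] the inner product is scalar, hence
    central, and slides out. Idempotence [k * k = k] then keeps the product at factor [k].
    Transposition carries the left case to the right one. *)

Lemma idempotent_scalar_mx_mul (R : comNzRingType) (n : nat) (k : R) :
  k ^+ 2 = k -> k%:M *m k%:M = k%:M :> 'M[R]_n.
Proof. by move=> hk; rewrite -scalar_mxM -expr2 hk. Qed.

Lemma mulmx_left_orthogonal (R : comNzRingType) (n : nat) (k l : R)
    (A B : 'M[R]_n) :
  left_orthogonal k A -> left_orthogonal l B ->
  left_orthogonal (k * l) (A *m B).
Proof.
move=> /eqP hA /eqP hB; apply/eqP.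
by rewrite trmx_mul mulmxA -(mulmxA B^T) hA scalar_mxC -mulmxA hB scalar_mxM.
Qed.

Lemma right_orthogonal_trmx (R : nzRingType) (n : nat) (k : R)
    (A : 'M[R]_n) :
  right_orthogonal k A = left_orthogonal k A^T.
Proof. by rewrite /left_orthogonal trmxK. Qed.

Theorem proposition3p8 (R : finComNzRingType) (n : nat) (k : R)
    (hk : k ^+ 2 = k) (hn : (2 <= n)%N) :
  is_semigroup (fun A B : 'M[R]_n => A *m B) (LO n k) /\
  is_semigroup (fun A B : 'M[R]_n => A *m B) (RO n k).
Proof.
have hkk : k * k = k by rewrite -expr2.
split; split=> [|A B|A B C _ _ _]; try exact: mulmxA.
(* The scalar matrix [k%:M] is symmetric and, as [k] is idempotent, its own square. *)
- apply/set0Pn; exists k%:M; rewrite inE; apply/eqP.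
  by rewrite tr_scalar_mx idempotent_scalar_mx_mul.
- by rewrite !inE => hA hB; rewrite -hkk mulmx_left_orthogonal.
- apply/set0Pn; exists k%:M; rewrite inE; apply/eqP.
  by rewrite tr_scalar_mx idempotent_scalar_mx_mul.
(* Transposing reverses the product to [B^T *m A^T]; this is harmless, as both factors share the
   same [k]. *)
- rewrite !inE !right_orthogonal_trmx trmx_mul => hA hB.
  by rewrite -hkk mulmx_left_orthogonal.
Qed.
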